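(* Let $m>0$, $\Lambda>0$ and $\xi\ge\frac{\sqrt{27}}{64\,m}$ be real numbers. For $r>0$ put $$h(r)=1-\frac{2m}{r}-\frac{\Lambda r^2}{3},\qquad Q(r)=1-h(r)-\frac{h(r)\,h'(r)^2}{4\xi^2}.$$ Then $Q(r)\ge0$ for all $r>0$, and there is a choice of signs $\sigma:(0,\infty)\to\{1,-1\}$ such that $\sigma\sqrt Q$ is smooth on $(0,\infty)$. For such a choice, let $\chi$ be an antiderivative of $\sigma\sqrt Q$ on $(0,\infty)$. Then the map $y:\mathbb R\times(0,\infty)\times S^2\to\mathbb R^{1,5}$ given in coordinates $u\in\mathbb R$, $r>0$, $(\theta,\phi)\in S^2$ by $$y^0=\frac{\xi^2}{6}u^3+\frac{h(r)+1}{2}u+\chi(r),\quad y^1=\frac{\xi^2}{6}u^3+\frac{h(r)-1}{2}u+\chi(r),\quad y^2=\frac{\xi}{2}u^2+\frac{1}{2\xi}h(r),$$ $$y^3=r\cos\theta,\quad y^4=r\sin\theta\cos\phi,\quad y^5=r\sin\theta\sin\phi$$ is a smooth embedding (in particular smooth for all $r>0$, including the zeros of $h$) which is an isometric embedding of the Schwarzschild-de Sitter metric: on each connected component of $\{r>0: h(r)\ne0\}$, with the time coordinate $t$ defined by $$u=t-\int\frac{\chi'(r)}{h(r)}\,dr,$$ the metric induced by $y$ from $\mathbb R^{1,5}$ equals $$ds^2=h(r)\,dt^2-\frac{dr^2}{h(r)}-r^2\,(d\theta^2+\sin^2\theta\,d\phi^2).$$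
   Context: $\mathbb R^{1,5}$ denotes $\mathbb R^6$ with coordinates $y^0,\dots,y^5$ and the flat metric $\eta=(dy^0)^2-(dy^1)^2-(dy^2)^2-(dy^3)^2-(dy^4)^2-(dy^5)^2$ (signature $(+-----)$). The metric induced by a map $y$ is the pullback $g_{\mu\nu}=\partial_\mu y^a\,\partial_\nu y^b\,\eta_{ab}$. $(\theta,\phi)$ are the standard spherical coordinates on the unit sphere $S^2$; the expressions $(\cos\theta,\sin\theta\cos\phi,\sin\theta\sin\phi)$ define the standard inclusion $S^2\subset\mathbb R^3$. The indefinite integral in the relation between $u$ and $t$ means any antiderivative on the given connected component of $\{h\ne0\}$. The metric $ds^2$ is the Schwarzschild-de Sitter metric with mass $m$ and cosmological constant $\Lambda$; the positive zeros of $h$ (if any) are its horizons. *)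

(* Defs.v *)
From mathcomp Require Import all_boot all_order all_algebra.
From mathcomp Require Import all_classical all_reals all_analysis.

Set Implicit Arguments.
Unset Strict Implicit.
Unset Printing Implicit Defensive.

Import Order.TTheory GRing.Theory Num.Theory.
Import numFieldNormedType.Exports.

Local Open Scope classical_set_scope.
Local Open Scope ring_scope.

Section Smoothness.
Context {R : realType}.

(* All iterated directional derivatives of order at most [k] exist and are
   continuous on [U].  For [U] open and [V] finite-dimensional (the only case
   used here) this is the usual class C^k. *)
Fixpoint Ck_on (V W : normedModType R) (k : nat) (U : set V) (f : V -> W)
    : Prop :=
  (forall x, U x -> {for x, continuous f}) /\
  if k is k'.+1 then
    forall v : V, (forall x, U x -> derivable f x v) /\ Ck_on k' U ('D_v f)
  else True.

Definition smooth_on (V W : normedModType R) (U : set V) (f : V -> W) : Prop :=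
  forall k, Ck_on k U f.

(* Below, [M] is a submanifold of [V]; only the restriction of [f] to [M]
   matters. Smoothness of a map on [M] is local smooth extendability. *)
Definition smooth_map (V W : normedModType R) (M : set V) (f : V -> W) : Prop :=
  forall p, M p -> exists (U : set V) (F : V -> W),
    [/\ open U, U p, smooth_on U F & forall q, U q -> M q -> f q = F q].

Definition smooth_curve (V : normedModType R) (M : set V) (p : V)
    (c : R -> V) : Prop :=
  c 0 = p /\ exists2 e : R, 0 < e &
    smooth_on [set s : R | `|s| < e] c /\ (forall s, `|s| < e -> M (c s)).

(* The tangent space of [M] at [p] consists of the velocities at 0 of the
   smooth curves in [M] through [p], and the differential of [f] sends the
   velocity of [c] to that of [f \o c]; it is required to be injective. *)
Definition immersion (V W : normedModType R) (M : set V) (f : V -> W) : Prop :=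
  forall p, M p -> forall c1 c2 : R -> V,
    smooth_curve M p c1 -> smooth_curve M p c2 ->
    derive1 (f \o c1) 0 = derive1 (f \o c2) 0 -> derive1 c1 0 = derive1 c2 0.

Definition topological_embedding (V W : topologicalType) (M : set V)
    (f : V -> W) : Prop :=
  {within M, continuous f} /\
  exists g : W -> V, (forall p, M p -> g (f p) = p) /\
    {within f @` M, continuous g}.

Definition smooth_embedding (V W : normedModType R) (M : set V)
    (f : V -> W) : Prop :=
  [/\ smooth_map M f, immersion M f & topological_embedding M f].

End Smoothness.

Section SchwarzschildDeSitter.
Context {R : realType}.

Definition eta : 'M[R]_6 :=
  \matrix_(a, b) if a == b then (if a == 0 then 1 else -1) else 0.

Definition eta_form (v w : 'rV[R]_6) : R :=
  \sum_a \sum_b v 0 a * w 0 b * eta a b.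

Definition dot (n : nat) (v w : 'rV[R]_n) : R := \sum_i v 0 i * w 0 i.

(* R x (0, oo) x S^2, as a subset of R x R x R^3; the points are (u, r, w) *)
Definition spacetime : set (R * R * 'rV[R]_3) :=
  [set p | 0 < p.1.2 /\ dot p.2 p.2 = 1].

Definition sph (theta phi : R) : 'rV[R]_3 :=
  \row_i [:: cos theta; sin theta * cos phi; sin theta * sin phi]`_i.

Definition h (m Lambda r : R) : R := 1 - 2 * m / r - Lambda * r ^+ 2 / 3.

Definition Q (m Lambda xi r : R) : R :=
  1 - h m Lambda r
    - h m Lambda r * (derive1 (h m Lambda) r) ^+ 2 / (4 * xi ^+ 2).

Definition y (m Lambda xi : R) (chi : R -> R) (p : R * R * 'rV[R]_3)
    : 'rV[R]_6 :=
  let u := p.1.1 in let r := p.1.2 in let w := p.2 in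
  \row_a [:: xi ^+ 2 / 6 * u ^+ 3 + (h m Lambda r + 1) / 2 * u + chi r;
             xi ^+ 2 / 6 * u ^+ 3 + (h m Lambda r - 1) / 2 * u + chi r;
             xi / 2 * u ^+ 2 + 1 / (2 * xi) * h m Lambda r;
             r * w 0 0; r * w 0 1; r * w 0 2]`_a.

(* The point with coordinates x = (t, r, theta, phi), for u = t - T r *)
Definition chart (T : R -> R) (x : 'rV[R]_4) : R * R * 'rV[R]_3 :=
  (x 0 0 - T (x 0 1), x 0 1, sph (x 0 2) (x 0 3)).

(* Entry (mu, nu) is \partial_mu Y^a \partial_nu Y^b eta_(ab). *)
Definition induced_metric (Y : 'rV[R]_4 -> 'rV[R]_6) (x : 'rV[R]_4)
    : 'M[R]_4 :=
  \matrix_(mu, nu) eta_form ('D_(delta_mx 0 mu) Y x) ('D_(delta_mx 0 nu) Y x).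

(* The metric in the coordinates (t, r, theta, phi) *)
Definition SdS_metric (m Lambda : R) (x : 'rV[R]_4) : 'M[R]_4 :=
  let r := x 0 1 in let theta := x 0 2 in
  diag_mx (\row_i [:: h m Lambda r; - (h m Lambda r)^-1; - r ^+ 2;
                      - (r ^+ 2 * sin theta ^+ 2)]`_i).

(* The same metric as a bilinear form on the tangent vectors c1'(0), c2'(0).
   Here dtheta^2 + sin^2 theta dphi^2 is the restriction to S^2 of the
   Euclidean metric of R^3, which also makes sense at the poles. *)
Definition SdS_form (m Lambda : R) (T : R -> R)
    (c1 c2 : R -> R * R * 'rV[R]_3) : R :=
  let r0 := (c1 0).1.2 in
  let t (c : R -> R * R * 'rV[R]_3) (s : R) : R := (c s).1.1 + T (c s).1.2 in
  let r (c : R -> R * R * 'rV[R]_3) (s : R) : R := (c s).1.2 in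
  let w (c : R -> R * R * 'rV[R]_3) (s : R) : 'rV[R]_3 := (c s).2 in
  h m Lambda r0 * (derive1 (t c1) 0 * derive1 (t c2) 0)
  - derive1 (r c1) 0 * derive1 (r c2) 0 / h m Lambda r0
  - r0 ^+ 2 * dot (derive1 (w c1) 0) (derive1 (w c2) 0).

End SchwarzschildDeSitter.

(* Main.v *)
From HB Require Import structures.
Require Import Defs.
From mathcomp Require Import all_boot all_order all_algebra.
From mathcomp Require Import all_classical all_reals all_analysis.
From mathcomp Require Import ring lra.
Import Order.TTheory GRing.Theory Num.Theory.
Import numFieldNormedType.Exports.
Local Open Scope classical_set_scope.
Local Open Scope ring_scope.

(** Since Lambda > 0, Q is strictly positive, so sigma = 1 is admissible.
    For any admissible sigma, chi' ^ 2 = Q, and the embedding is inverted on its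
    image by u = y0 - y1, r = |(y3, y4, y5)|, w = (y3, y4, y5) / r.  The u^2
    and u h' terms cancel in the pullback of eta, which leaves
    h du^2 + 2 chi' du dr - (1 + h'^2 / (4 xi^2)) dr^2 - r^2 dw^2; completing
    the square with dt = du + chi' / h dr gives the Schwarzschild-de Sitter
    metric because of the choice of Q. *)

(** * Directional derivatives *)

Section DirectionalDerivatives.
Set Implicit Arguments.
Unset Strict Implicit.
Context {R : realType}.
Implicit Types V W X : normedModType R.

(** Restricting [f] to the line through [x] along [v] gives the same difference quotients, which
    brings the one-variable chain rule within reach of [is_derive_comp]. *)
Lemma is_derive_lineP {V W} (f : V -> W) x v df :
  is_derive x v f df <-> is_derive (0 : R) 1 (fun s : R => f (s *: v + x)) df.
Proof.
have E : 'D_v f x = 'D_1 (fun s : R => f (s *: v + x)) 0.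
  rewrite /derive; set g1 := fun s => s^-1 *: _; set g2 := fun s => s^-1 *: _.
  suff -> : g1 = g2 by [].
  apply/funext => s; rewrite /g1 /g2 /=.
  by rewrite addr0 scale0r add0r [_%:A]mulr1.
by split=> -[d <-]; split; rewrite ?E //; apply/(derivable1P f x v).
Qed.

(** By linearity [L] commutes with the difference quotient, and by continuity with its limit.
    Projections and matrix coordinates are handled as instances. *)
Lemma is_derive_linear {V W X} (L : {linear W -> X}) (f : V -> W) x v df :
  continuous L -> is_derive x v f df -> is_derive x v (fun t => L (f t)) (L df).
Proof.
move=> cL [fxv <-].
have : (fun s : R => s^-1 *: (((fun t => L (f t)) \o shift x) (s *: v) - L (f x)))
    @ 0^' --> L ('D_v f x).
  rewrite (_ : (fun s : R => _) =
    L \o (fun s : R => s^-1 *: ((f \o shift x) (s *: v) - f x))).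
    by apply: continuous_cvg; [exact: cL | exact: fxv].
  by apply/funext => s /=; rewrite linearZZ (linearB L).
by move=> lim_L; split; [apply/cvg_ex; eexists; exact: lim_L | exact: cvg_lim].
Qed.

Lemma is_derive_comp {V} (g : R -> R) (f : V -> R) x v dg df :
  is_derive (f x) 1 g dg -> is_derive x v f df ->
  is_derive x v (fun t => g (f t)) (dg * df).
Proof.
move=> dg_ /is_derive_lineP df_; apply/is_derive_lineP.
apply: (@is_derive1_comp _ g (fun s : R => f (s *: v + x))) => //.
by rewrite scale0r add0r.
Qed.

Lemma is_derive_mx {V} m n (M : V -> 'M[R]_(m, n)) x v (dM : 'M[R]_(m, n)) :
  (forall i j, is_derive x v (fun t => M t i j) (dM i j)) ->
  is_derive x v M dM.
Proof.
move=> dMij.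
have Mxv : derivable M x v by apply/derivable_mxP => i j; apply: ex_derive.
split=> //; rewrite derive_mx //; apply/matrixP => i j; rewrite mxE.
exact: derive_val.
Qed.

Lemma fst_continuous {V W} : continuous (fst : V * W -> V).
Proof. by move=> p; exact: cvg_fst. Qed.

Lemma snd_continuous {V W} : continuous (snd : V * W -> W).
Proof. by move=> p; exact: cvg_snd. Qed.

(** Named so that the coordinate can carry a linear structure; [scale_of] below is named for the
    same reason. *)
Definition mx_coord {m n} (i : 'I_m) (j : 'I_n) (M : 'M[R]_(m, n)) : R := M i j.

Fact mx_coord_is_linear m n i j : linear (@mx_coord m n i j).
Proof. by move=> a A B; rewrite /mx_coord !mxE. Qed.

HB.instance Definition _ m n i j :=
  GRing.isLinear.Build R _ _ _ (@mx_coord m n i j) (@mx_coord_is_linear m n i j).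

Definition scale_of {V} (v : V) (a : R) : V := a *: v.

Fact scale_of_is_linear V (v : V) : linear (scale_of v : R^o -> V).
Proof. by move=> a b c; rewrite /scale_of scalerDl scalerA. Qed.

HB.instance Definition _ V (v : V) :=
  GRing.isLinear.Build R R^o V _ (scale_of v) (@scale_of_is_linear V v).

Lemma is_derive_fst {V W X} (f : V -> W * X) x v df :
  is_derive x v f df -> is_derive x v (fun t => (f t).1) df.1.
Proof. exact: is_derive_linear fst_continuous. Qed.

Lemma is_derive_snd {V W X} (f : V -> W * X) x v df :
  is_derive x v f df -> is_derive x v (fun t => (f t).2) df.2.
Proof. exact: is_derive_linear snd_continuous. Qed.

Lemma is_derive_mx_coord {V} m n (M : V -> 'M[R]_(m, n)) x v dM i j :
  is_derive x v M dM -> is_derive x v (fun t => M t i j) (dM i j).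
Proof. apply: (@is_derive_linear _ _ _ (mx_coord i j)); exact: coord_continuous. Qed.

Lemma is_derive_pair {V W X} (f : V -> W) (g : V -> X) x v df dg :
  is_derive x v f df -> is_derive x v g dg ->
  is_derive x v (fun t => (f t, g t)) (df, dg).
Proof.
move=> [df_ <-] [dg_ <-].
have lim_fg : (fun s : R => s^-1 *: (((fun t => (f t, g t)) \o shift x) (s *: v)
    - (f x, g x))) @ 0^' --> ('D_v f x, 'D_v g x).
  exact: (cvg_pair df_ dg_).
by split; [apply/cvg_ex; eexists; exact: lim_fg | exact: cvg_lim].
Qed.

(** This and the next two lemmas are the usual rules up to conversion, with operations on functions
    written pointwise and scaling of [R] by itself written as a product, to fit explicit
    formulas. *)
Lemma is_derive_mull {V} (a : R) (f : V -> R) x v df :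
  is_derive x v f df -> is_derive x v (fun t => a * f t) (a * df).
Proof. by move=> fdf; exact: is_deriveZ. Qed.

Lemma is_derive_mul {V} (f g : V -> R) x v df dg :
  is_derive x v f df -> is_derive x v g dg ->
  is_derive x v (fun t => f t * g t) (f x * dg + g x * df).
Proof. exact: is_deriveM. Qed.

Lemma is_derive_add {V} (f g : V -> R) x v df dg :
  is_derive x v f df -> is_derive x v g dg ->
  is_derive x v (fun t => f t + g t) (df + dg).
Proof. exact: is_deriveD. Qed.

End DirectionalDerivatives.

(** * C^k maps *)

Section CkCalculus.
Set Implicit Arguments.
Unset Strict Implicit.
Context {R : realType}.
Implicit Types V W X : normedModType R.

Lemma Ck_on_continuous {V W} k U (f : V -> W) :
  Ck_on k U f -> forall x, U x -> {for x, continuous f}.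
Proof. by case: k => [|k] []. Qed.

Lemma Ck_onW {V W} k U (f : V -> W) : Ck_on k.+1 U f -> Ck_on k U f.
Proof.
elim: k f => [|k IH] f [cf Df]; split => // v.
by have [dfv Cf] := Df v; split => //; exact: IH.
Qed.

Lemma near_open {V W} (U : set V) (f g : V -> W) x :
  open U -> U x -> (forall t, U t -> f t = g t) -> \near x, f x = g x.
Proof.
by move=> oU Ux fg; apply: filterS (open_nbhs_nbhs (conj oU Ux)) => t /fg.
Qed.

Lemma eq_for_continuous {V W} (U : set V) (f g : V -> W) x :
  open U -> U x -> (forall t, U t -> f t = g t) ->
  {for x, continuous f} -> {for x, continuous g}.
Proof.
move=> oU Ux fg cf; have nfg := near_open oU Ux fg.
rewrite /prop_for /continuous_at -(fg _ Ux); apply: cvg_trans cf.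
exact: near_eq_cvg.
Qed.

(** Openness turns equality on [U] into equality near each point of [U], which transfers continuity
    and derivatives. *)
Lemma eq_Ck_on {V W} k U (f g : V -> W) :
  open U -> (forall x, U x -> f x = g x) -> Ck_on k U f -> Ck_on k U g.
Proof.
move=> oU; elim: k f g => [|k IH] f g fg [cf Df].
  by split=> // x Ux; exact: eq_for_continuous fg (cf _ Ux).
split=> [x Ux|v]; first exact: eq_for_continuous fg (cf _ Ux).
have [dfv Cf] := Df v; split.
  by move=> x Ux; apply: near_eq_derivable (dfv _ Ux); exact: near_open Ux fg.
by apply: IH Cf => x Ux; apply: near_eq_derive; exact: near_open Ux fg.
Qed.

(** The usual entry point for inductions on the order: an explicit formula [df] need agree with
    ['D_v f] on [U] only. *)
Lemma Ck_onS {V W} k U (f : V -> W) : open U ->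
  (forall x, U x -> {for x, continuous f}) ->
  (forall v, exists2 df, forall x, U x -> is_derive x v f (df x)
                       & Ck_on k U df) ->
  Ck_on k.+1 U f.
Proof.
move=> oU cf Df; split=> // v; have [df dfE Cdf] := Df v; split.
  by move=> x /dfE[].
by apply: eq_Ck_on Cdf => // x /dfE[].
Qed.

Lemma Ck_on_is_derive {V W} k U (f : V -> W) x v :
  Ck_on k.+1 U f -> U x -> is_derive x v f ('D_v f x).
Proof. by move=> [_ /(_ v)[df _]] Ux; apply: derivableP; exact: df. Qed.

Lemma Ck_on_derive {V W} k U (f : V -> W) v :
  Ck_on k.+1 U f -> Ck_on k U ('D_v f).
Proof. by case=> _ /(_ v)[]. Qed.

Lemma Ck_on_cst {V W} k U (w : W) : open U -> Ck_on k U (fun _ : V => w).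
Proof.
move=> oU; elim: k w => [|k IH] w; first by split=> // x _; exact: cst_continuous.
apply: Ck_onS => // [x _|v]; first exact: cst_continuous.
by exists (fun _ => 0) => // x _; exact: is_derive_cst.
Qed.

Lemma Ck_on_linear {V W X} (L : {linear W -> X}) k U (f : V -> W) :
  continuous L -> open U -> Ck_on k U f -> Ck_on k U (fun x => L (f x)).
Proof.
move=> cL oU; elim: k f => [|k IH] f Cf.
  split=> // x Ux; apply: continuous_comp; last exact: cL.
  exact: Ck_on_continuous Cf _ Ux.
apply: Ck_onS => // [x Ux|v].
  apply: continuous_comp; last exact: cL.
  exact: Ck_on_continuous Cf _ Ux.
exists (fun x => L ('D_v f x)); last exact/IH/Ck_on_derive.
by move=> x Ux; apply: is_derive_linear => //; exact: Ck_on_is_derive Cf Ux.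
Qed.

Lemma Ck_on_id {V} k U : open U -> Ck_on k U (fun x : V => x).
Proof.
move=> oU; case: k => [|k]; first by split=> // x _.
apply: Ck_onS => // [x _|v]; first exact: cvg_id.
exists (fun=> v); last exact: Ck_on_cst.
by move=> x _; exact: is_derive_id.
Qed.

Lemma Ck_onD {V W} k U (f g : V -> W) : open U ->
  Ck_on k U f -> Ck_on k U g -> Ck_on k U (fun x => f x + g x).
Proof.
move=> oU; elim: k f g => [|k IH] f g Cf Cg.
  by split=> // x Ux; apply: continuousD; [exact: Ck_on_continuous Cf _ Ux
    | exact: Ck_on_continuous Cg _ Ux].
apply: Ck_onS => // [x Ux|v].
  by apply: continuousD; [exact: Ck_on_continuous Cf _ Ux
    | exact: Ck_on_continuous Cg _ Ux].
exists (fun x => 'D_v f x + 'D_v g x).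
  by move=> x Ux; apply: is_deriveD;
    [exact: Ck_on_is_derive Cf Ux | exact: Ck_on_is_derive Cg Ux].
by apply: IH; exact: Ck_on_derive.
Qed.

Lemma Ck_onM {V} k U (f g : V -> R) : open U ->
  Ck_on k U f -> Ck_on k U g -> Ck_on k U (fun x => f x * g x).
Proof.
move=> oU; elim: k f g => [|k IH] f g Cf Cg.
  by split=> // x Ux; apply: continuousM; [exact: Ck_on_continuous Cf _ Ux
    | exact: Ck_on_continuous Cg _ Ux].
apply: Ck_onS => // [x Ux|v].
  by apply: continuousM; [exact: Ck_on_continuous Cf _ Ux
    | exact: Ck_on_continuous Cg _ Ux].
exists (fun x => f x * 'D_v g x + g x * 'D_v f x).
  by move=> x Ux; apply: is_deriveM;
    [exact: Ck_on_is_derive Cf Ux | exact: Ck_on_is_derive Cg Ux].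
by apply: Ck_onD => //; apply: IH => //; do ?[exact: Ck_on_derive | exact: Ck_onW].
Qed.

Lemma Ck_onX {V} k U (f : V -> R) n : open U ->
  Ck_on k U f -> Ck_on k U (fun x => f x ^+ n).
Proof.
move=> oU Cf; elim: n => [|n IH]; first exact: Ck_on_cst.
by rewrite (_ : (fun x => _) = fun x => f x * f x ^+ n);
  [exact: Ck_onM | apply/funext => x; rewrite exprS].
Qed.

(** The induction runs over all [g] at once, because the chain rule applies it to ['D_1 g] composed
    with the same [f], the order of [f] being lowered by one. *)
Lemma Ck_on_comp {V} k U U' (g : R -> R) (f : V -> R) : open U ->
  (forall x, U x -> U' (f x)) -> Ck_on k U' g -> Ck_on k U f ->
  Ck_on k U (fun x => g (f x)).
Proof.
move=> oU fU; elim: k f g fU => [|k IH] f g fU Cg Cf.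
  split=> // x Ux; apply: continuous_comp; first exact: Ck_on_continuous Cf _ Ux.
  by apply: Ck_on_continuous Cg _ _; exact: fU.
apply: Ck_onS => // [x Ux|v].
  apply: continuous_comp; first exact: Ck_on_continuous Cf _ Ux.
  by apply: Ck_on_continuous Cg _ _; exact: fU.
exists (fun x => 'D_1 g (f x) * 'D_v f x).
  move=> x Ux; apply: is_derive_comp; last exact: Ck_on_is_derive Cf Ux.
  by apply: Ck_on_is_derive Cg _; exact: fU.
apply: Ck_onM => //; last exact: Ck_on_derive.
by apply: (IH f ('D_1 g)) => //; [exact: Ck_on_derive | exact: Ck_onW].
Qed.

Lemma Ck_on_sum {V W} k U n (f : 'I_n -> V -> W) : open U ->
  (forall i, Ck_on k U (f i)) -> Ck_on k U (fun x => \sum_i f i x).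
Proof.
(* Exposing the list of indices allows induction on that list. *)
move=> oU Cf; rewrite (_ : (fun x => _) = fun x => \sum_(i <- index_enum 'I_n) f i x) //.
elim: (index_enum _) => [|i s IH].
  apply: (@eq_Ck_on _ _ _ _ (fun=> 0)); rewrite //; last exact: Ck_on_cst.
  by move=> x _; rewrite big_nil.
apply: eq_Ck_on oU _ (Ck_onD oU (Cf i) IH) => x _; by rewrite big_cons.
Qed.

(** A matrix is the sum of its entries times elementary matrices, and each summand is a continuous
    linear image of one entry. *)
Lemma Ck_on_mx {V} m n k U (M : V -> 'M[R]_(m, n)) : open U ->
  (forall i j, Ck_on k U (fun x => M x i j)) -> Ck_on k U M.
Proof.
move=> oU CM; rewrite (_ : M = fun x => \sum_i \sum_j M x i j *: delta_mx i j).
  apply: Ck_on_sum => // i; apply: Ck_on_sum => // j.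
  apply: (Ck_on_linear (L := scale_of (delta_mx i j : 'M[R]_(m, n)))) => //.
  exact: scalel_continuous.
by apply/funext => x; exact: matrix_sum_delta.
Qed.

Lemma Ck_on_mx_coord k m n (U : set 'M[R]_(m, n)) i j :
  open U -> Ck_on k U (fun M => M i j).
Proof.
move=> oU; apply: (Ck_on_linear (L := mx_coord i j)) => //.
  exact: coord_continuous.
exact: Ck_on_id.
Qed.

(** On the line the derivative along [v] is [v] times the derivative along 1, so a single derivative
    controls all directions. *)
Lemma Ck_on_derive1 k (U : set R) (f df : R -> R) : open U ->
  (forall x, U x -> is_derive x 1 f (df x)) -> Ck_on k U df -> Ck_on k.+1 U f.
Proof.
move=> oU fdf Cdf; apply: Ck_onS => // [x /fdf[d _]|v].
  by apply/differentiable_continuous; apply/derivable1_diffP.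
exists (fun x => df x * v); last by apply: Ck_onM => //; exact: Ck_on_cst.
move=> x Ux.
by apply: (is_derive_comp (f := id)) => //; exact: fdf.
Qed.

End CkCalculus.

(** * The functions h and Q *)

Section Profile.
Set Implicit Arguments.
Unset Strict Implicit.
Context {R : realType}.
Implicit Types m L xi r : R.

Notation pos := [set r : R | 0 < r].

Lemma open_pos : open pos.
Proof. exact: open_gt. Qed.

(** The derivative is minus the square of the function itself, so each order yields the next. *)
Lemma Ck_on_inv k : Ck_on k pos (fun r : R => r^-1).
Proof.
have dinv r : 0 < r -> is_derive r 1 (fun r : R => r^-1) (-1 * (r^-1 * r^-1)).
  move=> r0; have rn0 : r != 0 by rewrite gt_eqF.
  apply: is_derive_eq (is_deriveV rn0 (is_derive_id _ _)) _.
  by rewrite /GRing.scale /=; field.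
elim: k => [|k IH].
  split=> // r r0; apply/differentiable_continuous/derivable1_diffP.
  by have [] := dinv r r0.
apply: Ck_on_derive1 open_pos dinv _.
do ?apply: Ck_onM => //; do ?exact: open_pos.
by apply: Ck_on_cst; exact: open_pos.
Qed.

(** The derivative is half the inverse of the root, so the induction closes through [Ck_on_inv]. *)
Lemma Ck_on_sqrt k : Ck_on k pos (@Num.sqrt R).
Proof.
have dsqrt r : 0 < r -> is_derive r 1 (@Num.sqrt R) (2^-1 * (Num.sqrt r)^-1).
  move=> r0; apply: is_derive_eq (is_derive1_sqrt r0) _.
  by rewrite invfM.
elim: k => [|k IH].
  by split=> // r r0; exact: sqrt_continuous.
apply: Ck_on_derive1 open_pos dsqrt _.
apply: Ck_onM; [exact: open_pos | exact/Ck_on_cst/open_pos |].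
apply: (Ck_on_comp (U' := pos)); [exact: open_pos | | exact: Ck_on_inv | exact: IH].
by move=> r /=; rewrite sqrtr_gt0.
Qed.

Definition dh m L r : R := 2 * m / r ^+ 2 - 2 * L * r / 3.

Lemma is_derive_h m L r : 0 < r -> is_derive r 1 (h m L) (dh m L r).
Proof.
move=> r0; have rn0 : r != 0 by rewrite gt_eqF.
have dV := is_deriveV rn0 (is_derive_id r (1 : R)).
have dX := is_deriveX 2 (is_derive_id r (1 : R)).
have := is_deriveB (is_deriveB (is_derive_cst (1 : R) r (1 : R))
  (is_deriveZ (2 * m) dV)) (is_deriveZ (L / 3) dX).
rewrite (_ : (_ - _ : R -> R) = h m L).
  move=> H; apply: is_derive_eq H _.
  by rewrite /dh /GRing.scale /=; field.
by apply/funext => t; rewrite /h !fctE /= -![_ *: _]/(_ * _); ring.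
Qed.

Lemma derive1_h m L r : 0 < r -> derive1 (h m L) r = dh m L r.
Proof. by move=> r0; rewrite derive1E; have [] := is_derive_h m L r0. Qed.

Lemma QE m L xi r : 0 < r ->
  Q m L xi r = 1 - h m L r - h m L r * dh m L r ^+ 2 / (4 * xi ^+ 2).
Proof. by move=> r0; rewrite /Q derive1_h. Qed.

Lemma Ck_on_h k m L : Ck_on k pos (h m L).
Proof.
have op := open_pos.
have : Ck_on k pos (fun r => 1 + (- (2 * m)) * r^-1 + (- (L / 3)) * r ^+ 2).
  apply: Ck_onD => //; first apply: Ck_onD => //; first exact: Ck_on_cst.
    by apply: Ck_onM => //; [exact: Ck_on_cst | exact: Ck_on_inv].
  apply: Ck_onM => //; first exact: Ck_on_cst.
  by apply: Ck_onX => //; exact: Ck_on_id.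
by apply: eq_Ck_on => // r _; rewrite /h; ring.
Qed.

Lemma Ck_on_dh k m L : Ck_on k pos (dh m L).
Proof.
apply: (@eq_Ck_on _ _ _ _ _ ('D_1 (h m L))); first exact: open_pos.
  by move=> r r0; have [] := is_derive_h m L r0.
exact/Ck_on_derive/Ck_on_h.
Qed.

Lemma Ck_on_Q k m L xi : Ck_on k pos (Q m L xi).
Proof.
have op := open_pos.
have : Ck_on k pos (fun r =>
    1 + (-1) * h m L r + (- (4 * xi ^+ 2)^-1) * (h m L r * dh m L r ^+ 2)).
  apply: Ck_onD => //; first apply: Ck_onD => //; first exact: Ck_on_cst.
    by apply: Ck_onM => //; [exact: Ck_on_cst | exact: Ck_on_h].
  apply: Ck_onM => //; first exact: Ck_on_cst.
  apply: Ck_onM => //; first exact: Ck_on_h.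
  by apply: Ck_onX => //; exact: Ck_on_dh.
by apply: eq_Ck_on => // r r0; rewrite QE //; ring.
Qed.

(* With a = 2m/r and b = Lambda r^2/3 one has h = 1 - a - b and
   h' = a (a - 2b) / (2m), so that this bound is Q > 0 for the least
   admissible xi, where 16 (m xi)^2 = 27/256. *)
Lemma quintic_bound (a b : R) : 0 < a -> 0 < b -> a + b < 1 ->
  256 * ((1 - a - b) * (a * (a - 2 * b)) ^+ 2) < 27 * (a + b).
Proof.
(* The split is on the sign of h'. In the first case 0 <= a - 2b <= a, which reduces the bound to (1
   - a) a^3 <= 27/256, with equality at a = 3/4. *)
move=> a0 b0 ab1; have [ab|ab] := lerP (2 * b) a.
  have H1 : (a * (a - 2 * b)) ^+ 2 <= (a ^+ 2) ^+ 2.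
    by rewrite ler_pXn2r// ?nnegrE; nra.
  have H2 : (1 - a - b) * (a * (a - 2 * b)) ^+ 2 <= (1 - a - b) * (a ^+ 2) ^+ 2.
    by apply: ler_wpM2l => //; lra.
  have H3 : 0 <= b * (a ^+ 2) ^+ 2 by rewrite mulr_ge0 ?exprn_ge0 // ltW.
  (* 27 - 256 (1 - a) a^3 = (4 a - 3)^2 (16 a^2 + 8 a + 3) *)
  have H4 : 0 <= a * ((4 * a - 3) ^+ 2 * (16 * a ^+ 2 + 8 * a + 3)).
    apply: mulr_ge0; first exact: ltW.
    apply: mulr_ge0; first exact: sqr_ge0.
    by have := sqr_ge0 a; lra.
  have H5 : a * ((4 * a - 3) ^+ 2 * (16 * a ^+ 2 + 8 * a + 3)) =
     27 * a - 256 * ((1 - a - b) * (a ^+ 2) ^+ 2) - 256 * (b * (a ^+ 2) ^+ 2) by ring.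
  lra.
(* (a + b)^2 - 3 a (2b - a) = (2a - b)^2 *)
have H1 : (a * (a - 2 * b)) ^+ 2 <= ((a + b) ^+ 2 / 3) ^+ 2.
  rewrite (_ : (a * (a - 2 * b)) ^+ 2 = (a * (2 * b - a)) ^+ 2); last by ring.
  have ? : 0 <= (a + b) ^+ 2 by exact: sqr_ge0.
  have ? : 0 <= a * (2 * b - a) by apply: mulr_ge0; lra.
  rewrite ler_pXn2r// ?nnegrE //; last by lra.
  by have := sqr_ge0 (2 * a - b); lra.
have H2 : (1 - a - b) * (a * (a - 2 * b)) ^+ 2 <=
    (1 - a - b) * ((a + b) ^+ 2 / 3) ^+ 2 by apply: ler_wpM2l => //; lra.
have s0 : 0 < a + b by lra.
set s := a + b in s0 ab1 H1 H2 *.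
have s2 : s ^+ 2 < 1 by rewrite expr_lt1 // ltW.
(* The square expands to s^4 - s^3 + s^2/4, and s^2 < 1. This crude bound suffices, since 256/9 *
   1/4 = 64/9 < 27. *)
have e : s ^+ 3 * (1 - s) <= 1 / 4 by have := sqr_ge0 (s ^+ 2 - s / 2); lra.
rewrite (_ : 1 - a - b = 1 - s) in H2 *; last by rewrite /s; ring.
have E : (1 - s) * (s ^+ 2 / 3) ^+ 2 = s * (s ^+ 3 * (1 - s)) / 9 by field.
rewrite E in H2.
have : s * (s ^+ 3 * (1 - s)) <= s * (1 / 4) by rewrite ler_pM2l.
lra.
Qed.

(** Strict positivity keeps Q inside the open half-line on which the square root is smooth. *)
Lemma Q_gt0 m L xi r : 0 < m -> 0 < L -> Num.sqrt 27 / (64 * m) <= xi ->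
  0 < r -> 0 < Q m L xi r.
Proof.
move=> m0 L0 hxi r0; rewrite QE //.
set a := 2 * m / r; set b := L * r ^+ 2 / 3.
have hE : h m L r = 1 - a - b by [].
have a0 : 0 < a by rewrite /a divr_gt0 // mulr_gt0.
have b0 : 0 < b by rewrite /b divr_gt0 // mulr_gt0 // exprn_gt0.
have rn0 : r != 0 by rewrite gt_eqF.
have mn0 : m != 0 by rewrite gt_eqF.
have dhE : dh m L r = a * (a - 2 * b) / (2 * m).
  by rewrite /dh /a /b; field; rewrite ?rn0 ?mn0.
have sq0 : 0 < Num.sqrt 27 :> R by rewrite sqrtr_gt0.
have xi0 : 0 < xi by apply: lt_le_trans hxi; rewrite divr_gt0 // mulr_gt0.
have xin0 : xi != 0 by rewrite gt_eqF.
(* The bound on [xi], squared. The constant 4096 = 64^2 = 256 * 16 matches the 256 of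
   [quintic_bound] and the denominator 16 (m xi)^2 below. *)
have hx2 : 27 <= 4096 * (m * xi) ^+ 2.
  rewrite -[X in X <= _](@sqr_sqrtr R 27) //.
  rewrite (_ : 4096 * _ = (xi * (64 * m)) ^+ 2); last by ring.
  have m64 : 0 < 64 * m by rewrite mulr_gt0.
  have le_sqrt : Num.sqrt 27 <= xi * (64 * m) by rewrite -ler_pdivrMr.
  by rewrite ler_pXn2r ?nnegrE // ltW // mulr_gt0.
have mx0 : 0 < (m * xi) ^+ 2 by rewrite exprn_gt0 // mulr_gt0.
rewrite hE dhE (_ : _ / (4 * xi ^+ 2) =
   ((1 - a - b) * (a * (a - 2 * b)) ^+ 2) / (16 * (m * xi) ^+ 2)); last first.
  by field; rewrite ?mn0 ?xin0.
rewrite (_ : 1 - (1 - a - b) = a + b); last by ring.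
rewrite subr_gt0 ltr_pdivrMr ?mulr_gt0 //.
(* If a + b >= 1 then h <= 0, so the term in h h'^2 does not decrease Q and 1 - h = a + b is
   positive. *)
have [ab1|ab1] := ltrP (a + b) 1; last first.
  apply: (@le_lt_trans _ _ 0); last by rewrite !mulr_gt0 // addr_gt0.
  by rewrite mulr_le0_ge0 ?sqr_ge0 //; lra.
have := quintic_bound a0 b0 ab1.
have : (a + b) * 27 <= (a + b) * (4096 * (m * xi) ^+ 2).
  by rewrite ler_pM2l // addr_gt0.
lra.
Qed.

End Profile.

(** * Coordinate formulas for the two bilinear forms *)

Section Coordinates.
Set Implicit Arguments.
Unset Strict Implicit.
Context {R : realType}.

Lemma dotE (v w : 'rV[R]_3) :
  dot v w = v 0 0 * w 0 0 + v 0 1 * w 0 1 + v 0 2 * w 0 2.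
Proof.
rewrite /dot !big_ord_recl big_ord0 addr0 addrA.
(* The lifted ordinals left by [big_ord_recl] agree with the numerals through their values. *)
by congr (_ + v 0 _ * w 0 _ + v 0 _ * w 0 _); exact: val_inj.
Qed.

Lemma eta_formE (v w : 'rV[R]_6) :
  eta_form v w = v 0 0 * w 0 0 - v 0 1 * w 0 1 - v 0 2 * w 0 2
    - v 0 3 * w 0 3 - v 0 4 * w 0 4 - v 0 5 * w 0 5.
Proof.
have E (a : 'I_6) : \sum_b v 0 a * w 0 b * eta a b =
    (if a == 0 then 1 else -1) * (v 0 a * w 0 a).
  rewrite (bigD1 a) //= big1 ?addr0; last first.
    by move=> b ab; rewrite mxE eq_sym (negbTE ab) mulr0.
  by rewrite mxE eqxx mulrC.
rewrite /eta_form (eq_bigr _ (fun a _ => E a)) !big_ord_recl big_ord0 /=.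
rewrite addr0 mul1r !mulN1r !addrA.
by congr (_ - v 0 _ * w 0 _ - v 0 _ * w 0 _ - v 0 _ * w 0 _ - v 0 _ * w 0 _
  - v 0 _ * w 0 _); exact: val_inj.
Qed.

End Coordinates.

(** * The embedding and its differential *)

Section Embedding.
Set Implicit Arguments.
Unset Strict Implicit.
Context {R : realType}.
Implicit Types (m L xi dchi : R) (chi : R -> R) (p dp : R * R * 'rV[R]_3).

(* The differential of y at p, applied to dp, when chi' = dchi at p. *)
Definition dy m L xi dchi p dp : 'rV[R]_6 :=
  let u := p.1.1 in let r := p.1.2 in let w := p.2 in
  let du := dp.1.1 in let dr := dp.1.2 in let dw := dp.2 in
  \row_a [:: xi ^+ 2 / 2 * u ^+ 2 * du
               + (dh m L r * dr * u + (h m L r + 1) * du) / 2 + dchi * dr;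
             xi ^+ 2 / 2 * u ^+ 2 * du
               + (dh m L r * dr * u + (h m L r - 1) * du) / 2 + dchi * dr;
             xi * u * du + 1 / (2 * xi) * (dh m L r * dr);
             dr * w 0 0 + r * dw 0 0; dr * w 0 1 + r * dw 0 1;
             dr * w 0 2 + r * dw 0 2]`_a.

Lemma is_derive_y (V : normedModType R) m L xi chi dchi
    (c : V -> R * R * 'rV[R]_3) x v dc :
  0 < (c x).1.2 -> is_derive (c x).1.2 1 chi dchi -> is_derive x v c dc ->
  is_derive x v (y m L xi chi \o c) (dy m L xi dchi (c x) dc).
Proof.
move=> r0 chi' c'.
have u' := is_derive_fst (is_derive_fst c').
have r' := is_derive_snd (is_derive_fst c').
have w' i := is_derive_mx_coord 0 i (is_derive_snd c').
have h' := is_derive_comp (f := fun t => (c t).1.2) (is_derive_h m L r0) r'.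
have chir' := is_derive_comp (f := fun t => (c t).1.2) chi' r'.
have u2' := is_derive_mul u' u'.
have u3' := is_derive_mul u' u2'.
have cst' (a : R) := is_derive_cst a x v.
apply: is_derive_mx => i j; rewrite (ord1 i).
(* One goal per component. Powers are unfolded into the nested products differentiated by [u2'] and
   [u3']. *)
case: j => -[|[|[|[|[|[|//]]]]]] j6; rewrite !mxE /=;
  under [X in is_derive _ _ X]eq_fun do rewrite mxE /= ?exprS ?expr0 ?mulr1.
- have H := is_derive_add (is_derive_add (is_derive_mull (xi ^+ 2 / 6) u3')
    (is_derive_mul (is_derive_mul (is_derive_add h' (cst' 1)) (cst' 2^-1)) u'))
    chir'.
  by apply: is_derive_eq H _; rewrite /=; field.
- have H := is_derive_add (is_derive_add (is_derive_mull (xi ^+ 2 / 6) u3')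
    (is_derive_mul (is_derive_mul (is_derive_add h' (cst' (-1))) (cst' 2^-1)) u'))
    chir'.
  by apply: is_derive_eq H _; rewrite /=; field.
- have H := is_derive_add (is_derive_mull (xi / 2) u2')
    (is_derive_mull (1 / (2 * xi)) h').
  by apply: is_derive_eq H _; congr (_ + _); field.
- by apply: is_derive_eq (is_derive_mul r' (w' _)) _; rewrite addrC mulrC.
- by apply: is_derive_eq (is_derive_mul r' (w' _)) _; rewrite addrC mulrC.
- by apply: is_derive_eq (is_derive_mul r' (w' _)) _; rewrite addrC mulrC.
Qed.

Lemma yE m L xi chi p :
  let: Y := y m L xi chi p in let: r := p.1.2 in
  [/\ Y 0 0 - Y 0 1 = p.1.1, Y 0 3 = r * p.2 0 0, Y 0 4 = r * p.2 0 1
    & Y 0 5 = r * p.2 0 2].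
Proof. by split; rewrite !mxE //=; field. Qed.

(** The pullback of eta in polarised form: du + (chi'/h) dr stands for dt, and the orthogonality
    conditions say that both vectors are tangent to the sphere. *)
Lemma eta_dy m L xi dchi p dp1 dp2 :
  let: w := p.2 in let: hr := h m L p.1.2 in
  0 < p.1.2 -> xi != 0 -> hr != 0 -> dchi ^+ 2 = Q m L xi p.1.2 ->
  dot w w = 1 -> dot w dp1.2 = 0 -> dot w dp2.2 = 0 ->
  eta_form (dy m L xi dchi p dp1) (dy m L xi dchi p dp2) =
  hr * ((dp1.1.1 + dchi / hr * dp1.1.2) * (dp2.1.1 + dchi / hr * dp2.1.2))
  - dp1.1.2 * dp2.1.2 / hr - p.1.2 ^+ 2 * dot dp1.2 dp2.2.
Proof.
move: p dp1 dp2 => [[u r] w] [[u1 r1] w1] [[u2 r2] w2] /= r0 xi0 h0 dchi2.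
rewrite QE // in dchi2; move=> ww ww1 ww2.
(* The Euclidean product of the differentials of r w: the cross terms vanish by tangency and |w| = 1
   leaves dr^2. *)
have E : r1 * r2 + r ^+ 2 * dot w1 w2 =
    (r1 * w 0 0 + r * w1 0 0) * (r2 * w 0 0 + r * w2 0 0)
  + (r1 * w 0 1 + r * w1 0 1) * (r2 * w 0 1 + r * w2 0 1)
  + (r1 * w 0 2 + r * w1 0 2) * (r2 * w 0 2 + r * w2 0 2).
  transitivity (r1 * r2 * dot w w + r * r1 * dot w w2 + r * r2 * dot w w1
    + r ^+ 2 * dot w1 w2); last by rewrite !dotE; ring.
  by rewrite ww ww1 ww2; ring.
have -> : r ^+ 2 * dot w1 w2 =
    (r1 * w 0 0 + r * w1 0 0) * (r2 * w 0 0 + r * w2 0 0)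
  + (r1 * w 0 1 + r * w1 0 1) * (r2 * w 0 1 + r * w2 0 1)
  + (r1 * w 0 2 + r * w1 0 2) * (r2 * w 0 2 + r * w2 0 2) - r1 * r2.
  by rewrite -E addrC addKr.
rewrite eta_formE !mxE /=.
apply/eqP; rewrite -subr_eq0; apply/eqP.
(* The two sides differ exactly by (dr1 dr2 / h) (Q - chi'^2). *)
transitivity (r1 * r2 / h m L r * (1 - h m L r
    - h m L r * dh m L r ^+ 2 / (4 * xi ^+ 2) - dchi ^+ 2)); last first.
  by rewrite dchi2 subrr mulr0.
by field; rewrite ?h0 ?xi0.
Qed.

(** The first two components differ by du, pairing the last three with w gives dr, and what remains
    of these is r dw. The argument is uniform in r, horizons included. *)
Lemma dy_inj m L xi dchi p dp1 dp2 : 0 < p.1.2 ->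
  dot p.2 p.2 = 1 -> dot p.2 dp1.2 = 0 -> dot p.2 dp2.2 = 0 ->
  dy m L xi dchi p dp1 = dy m L xi dchi p dp2 -> dp1 = dp2.
Proof.
move: p dp1 dp2 => [[u r] w] [[u1 r1] w1] [[u2 r2] w2] /= r0 ww ww1 ww2 E.
have rn0 : r != 0 by rewrite gt_eqF.
have Ei i : dy m L xi dchi (u, r, w) (u1, r1, w1) 0 i =
            dy m L xi dchi (u, r, w) (u2, r2, w2) 0 i by rewrite E.
move: (Ei 0) (Ei 1) (Ei 3) (Ei 4) (Ei 5); rewrite !mxE /= => E0 E1 E3 E4 E5.
rewrite !dotE in ww ww1 ww2.
have r12 : r1 = r2.
  have : r1 * (w 0 0 * w 0 0 + w 0 1 * w 0 1 + w 0 2 * w 0 2)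
         + r * (w 0 0 * w1 0 0 + w 0 1 * w1 0 1 + w 0 2 * w1 0 2) =
         r2 * (w 0 0 * w 0 0 + w 0 1 * w 0 1 + w 0 2 * w 0 2)
         + r * (w 0 0 * w2 0 0 + w 0 1 * w2 0 1 + w 0 2 * w2 0 2).
    transitivity (w 0 0 * (r1 * w 0 0 + r * w1 0 0)
      + w 0 1 * (r1 * w 0 1 + r * w1 0 1) + w 0 2 * (r1 * w 0 2 + r * w1 0 2)).
      by ring.
    by rewrite E3 E4 E5; ring.
  by rewrite ww ww1 ww2 !mulr1 mulr0 !addr0.
subst r2; congr (_, _, _); first lra.
apply/rowP => i; apply: (mulfI rn0).
case: i => -[|[|[|//]]] i3.
- by rewrite (_ : Ordinal i3 = 0); [exact: addrI E3 | exact: val_inj].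
- by rewrite (_ : Ordinal i3 = 1); [exact: addrI E4 | exact: val_inj].
- by rewrite (_ : Ordinal i3 = 2); [exact: addrI E5 | exact: val_inj].
Qed.

(** An open neighbourhood of [spacetime] in the ambient space, without the sphere condition. The
    formula for [y] is smooth there and so serves as its own extension. *)
Definition exterior : set (R * R * 'rV[R]_3) := [set p | 0 < p.1.2].

Lemma open_exterior : open exterior.
Proof.
rewrite (_ : exterior = (fun p => p.1.2) @^-1` [set r : R | 0 < r]) //.
apply: open_comp; last exact: open_pos.
move=> p _; apply: (@continuous_comp _ _ _ fst snd).
  exact: fst_continuous.
exact: snd_continuous.
Qed.

Lemma Ck_on_y k m L xi chi :
  Ck_on k [set r : R | 0 < r] chi -> Ck_on k exterior (y m L xi chi).
Proof.
move=> Cchi; have oE := open_exterior.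
have Cp : Ck_on k exterior (fun p : R * R * 'rV[R]_3 => p) by exact: Ck_on_id.
have C1 : Ck_on k exterior (fun p : R * R * 'rV[R]_3 => p.1).
  exact: (Ck_on_linear (L := fst)) fst_continuous oE Cp.
have Cu : Ck_on k exterior (fun p : R * R * 'rV[R]_3 => p.1.1).
  exact: (Ck_on_linear (L := fst)) fst_continuous oE C1.
have Cr : Ck_on k exterior (fun p : R * R * 'rV[R]_3 => p.1.2).
  exact: (Ck_on_linear (L := snd)) snd_continuous oE C1.
have C2 : Ck_on k exterior (fun p : R * R * 'rV[R]_3 => p.2).
  exact: (Ck_on_linear (L := snd)) snd_continuous oE Cp.
have Cw i : Ck_on k exterior (fun p : R * R * 'rV[R]_3 => p.2 0 i).
  exact: (Ck_on_linear (L := mx_coord 0 i)) (@coord_continuous _ _ _ _ _) oE C2.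
have Ch : Ck_on k exterior (fun p => h m L p.1.2).
  exact: Ck_on_comp oE _ (Ck_on_h k m L) Cr.
have Cc : Ck_on k exterior (fun p => chi p.1.2).
  exact: Ck_on_comp oE _ Cchi Cr.
apply: Ck_on_mx => // i j; rewrite (ord1 i).
by case: j => -[|[|[|[|[|[|//]]]]]] j6;
  under [X in Ck_on _ _ X]eq_fun do rewrite mxE /=;
  do ?[apply: Ck_onD => // | apply: Ck_onM => // | apply: Ck_onX => //
    | apply: Ck_on_cst => //].
Qed.

(** * Continuous inverse on the image *)

Definition sqrad (v : 'rV[R]_6) : R := v 0 3 ^+ 2 + v 0 4 ^+ 2 + v 0 5 ^+ 2.

(** Total on R^6: where [sqrad] vanishes the inverse of the root takes its default value 0, but on
    the image [sqrad] is r^2 > 0. *)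
Definition y_inv (v : 'rV[R]_6) : R * R * 'rV[R]_3 :=
  (v 0 0 - v 0 1, Num.sqrt (sqrad v),
   \row_i ([:: v 0 3; v 0 4; v 0 5]`_i * (Num.sqrt (sqrad v))^-1)).

Lemma sqrad_y m L xi chi p :
  spacetime p -> sqrad (y m L xi chi p) = p.1.2 ^+ 2.
Proof.
rewrite /sqrad; case=> r0 ww; have [_ -> -> ->] := yE m L xi chi p.
transitivity (p.1.2 ^+ 2 * dot p.2 p.2); first by rewrite dotE; ring.
by rewrite ww mulr1.
Qed.

Lemma yK m L xi chi p : spacetime p -> y_inv (y m L xi chi p) = p.
Proof.
move=> Mp; have [r0 _] := Mp; have [E0 E3 E4 E5] := yE m L xi chi p.
rewrite /y_inv sqrad_y // sqrtr_sqr gtr0_norm // E0 E3 E4 E5.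
move: p r0 {Mp E0 E3 E4 E5} => [[u r] w] /= r0; congr (_, _, _).
have rn0 : r != 0 by rewrite gt_eqF.
apply/rowP; case=> -[|[|[|//]]] i3; rewrite mxE /= mulrC mulKf //;
  congr (w 0 _); exact: val_inj.
Qed.

Lemma Ck_on_sqrad k U : open U -> Ck_on k U sqrad.
Proof.
by move=> oU; do ?[apply: Ck_onD => // | apply: Ck_onX => //
  | apply: Ck_on_mx_coord => //].
Qed.

(** Order 0 of [Ck_on] expresses continuity on an open set, so the closure lemmas apply. *)
Lemma y_inv_continuous v : 0 < sqrad v -> {for v, continuous y_inv}.
Proof.
move=> v0; pose U : set 'rV[R]_6 := [set v | 0 < sqrad v].
have oU : open U.
  rewrite (_ : U = sqrad @^-1` [set r : R | 0 < r]) //.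
  apply: open_comp; last exact: open_pos.
  by move=> w _; apply: Ck_on_continuous (Ck_on_sqrad 0 openT) _ _.
have Crad : Ck_on 0 U (fun v => Num.sqrt (sqrad v)).
  apply: (Ck_on_comp (U' := [set r : R | 0 < r])) => //; first exact: Ck_on_sqrt.
  exact: Ck_on_sqrad.
have Cinv : Ck_on 0 U (fun v => (Num.sqrt (sqrad v))^-1).
  apply: (Ck_on_comp (U' := [set r : R | 0 < r])) Crad => //; last exact: Ck_on_inv.
  by move=> w Uw /=; rewrite sqrtr_gt0.
have Cw : Ck_on 0 U (fun v : 'rV[R]_6 =>
    \row_(i < 3) ([:: v 0 3; v 0 4; v 0 5]`_i * (Num.sqrt (sqrad v))^-1)).
  apply: Ck_on_mx => // i j; rewrite (ord1 i).
  by case: j => -[|[|[|//]]] j3; under [X in Ck_on _ _ X]eq_fun do rewrite mxE /=;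
    apply: Ck_onM => //; exact: Ck_on_mx_coord.
have Cu : {for v, continuous (fun w : 'rV[R]_6 => w 0 0 - w 0 1)}.
  by apply: continuousB; exact: coord_continuous.
exact: cvg_pair (cvg_pair Cu (Ck_on_continuous Crad v0)) (Ck_on_continuous Cw v0).
Qed.

Lemma topological_embedding_y m L xi chi :
  Ck_on 0 [set r : R | 0 < r] chi ->
  topological_embedding spacetime (y m L xi chi).
Proof.
move=> /Ck_on_y Cy; split.
  apply: continuous_in_subspaceT => p; rewrite inE => -[r0 _].
  exact: Ck_on_continuous (Cy m L xi) _ r0.
exists y_inv; split; first exact: yK.
apply: continuous_in_subspaceT => v; rewrite inE => -[p Mp <-].
apply: y_inv_continuous; rewrite sqrad_y //; have [r0 _] := Mp.
by rewrite exprn_gt0.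
Qed.

Lemma smooth_map_y m L xi chi :
  (forall k, Ck_on k [set r : R | 0 < r] chi) ->
  smooth_map spacetime (y m L xi chi).
Proof.
move=> Cchi p [r0 _]; exists exterior, (y m L xi chi); split=> //.
  exact: open_exterior.
by move=> k; exact: Ck_on_y.
Qed.

(** * Velocities of curves and the immersion property *)

Lemma smooth_curve_is_derive p c : smooth_curve spacetime p c ->
  [/\ c 0 = p, is_derive (0 : R) 1 c (derive1 c 0)
    & dot p.2 (derive1 c 0).2 = 0].
Proof.
move=> [c0 [e e0 [Cc Mc]]]; have c' : is_derive (0 : R) 1 c (derive1 c 0).
  rewrite derive1E; apply: (Ck_on_is_derive _ (Cc 1%N)).
  by rewrite /= normr0.
split=> //; rewrite -c0; move: (derive1 c 0) c' => dc c'.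
have w' i := is_derive_mx_coord 0 i (is_derive_snd c').
have dot' : is_derive (0 : R) 1 (fun s => dot (c s).2 (c s).2)
    (2 * dot (c 0).2 dc.2).
  under [X in is_derive _ _ X]eq_fun do rewrite dotE.
  apply: is_derive_eq (is_derive_add (is_derive_add (is_derive_mul (w' 0) (w' 0))
    (is_derive_mul (w' 1) (w' 1))) (is_derive_mul (w' 2) (w' 2))) _.
  by rewrite dotE; ring.
(* The curve stays on the sphere near 0, so the derivative of |w|^2, which is twice the wanted
   product, vanishes at 0. *)
have near1 : \forall s \near (0 : R), dot (c s).2 (c s).2 = cst 1 s.
  by apply: filterS (@nbhs0_lt _ R _ e0) => s /Mc[_ ->].
have := near_eq_derive (1 : R^o) near1; rewrite derive_cst.
rewrite (derive_val (is_derive := dot')).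
lra.
Qed.

Lemma derive1_y m L xi chi dchi (c : R -> R * R * 'rV[R]_3) dc :
  0 < (c 0).1.2 -> is_derive (c 0).1.2 1 chi dchi -> is_derive (0 : R) 1 c dc ->
  derive1 (y m L xi chi \o c) 0 = dy m L xi dchi (c 0) dc.
Proof.
by move=> r0 chi' c'; rewrite derive1E; have [] := is_derive_y m L xi r0 chi' c'.
Qed.

Lemma immersion_y m L xi chi (dchi : R -> R) :
  (forall r : R, 0 < r -> is_derive r 1 chi (dchi r)) ->
  immersion spacetime (y m L xi chi).
Proof.
move=> chi' p [r0 ww] c1 c2.
move=> /smooth_curve_is_derive[c10 c1' ww1] /smooth_curve_is_derive[c20 c2' ww2].
have dyE c : c 0 = p -> is_derive (0 : R) 1 c (derive1 c 0) ->
    derive1 (y m L xi chi \o c) 0 = dy m L xi (dchi p.1.2) p (derive1 c 0).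
  by move=> c0 c'; rewrite -c0; apply: derive1_y; rewrite ?c0 //; exact: chi'.
rewrite (dyE _ c10 c1') (dyE _ c20 c2').
exact: dy_inj r0 ww ww1 ww2.
Qed.

(** * Spherical coordinates and the chart *)

Definition dsph (theta phi dtheta dphi : R) : 'rV[R]_3 :=
  \row_i [:: - sin theta * dtheta;
             cos theta * cos phi * dtheta - sin theta * sin phi * dphi;
             cos theta * sin phi * dtheta + sin theta * cos phi * dphi]`_i.

Lemma is_derive_sph (V : normedModType R) (f g : V -> R) x v df dg :
  is_derive x v f df -> is_derive x v g dg ->
  is_derive x v (fun t => sph (f t) (g t)) (dsph (f x) (g x) df dg).
Proof.
move=> f' g'.
have cosf := is_derive_comp (is_derive_cos (f x)) f'.
have sinf := is_derive_comp (is_derive_sin (f x)) f'.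
have cosg := is_derive_comp (is_derive_cos (g x)) g'.
have sing := is_derive_comp (is_derive_sin (g x)) g'.
apply: is_derive_mx => i j; rewrite (ord1 i).
case: j => -[|[|[|//]]] j3; rewrite mxE /=;
  under [X in is_derive _ _ X]eq_fun do rewrite mxE /=.
- exact: cosf.
- by apply: is_derive_eq (is_derive_mul sinf cosg) _; ring.
- by apply: is_derive_eq (is_derive_mul sinf sing) _; ring.
Qed.

Lemma dot_sph (theta phi : R) : dot (sph theta phi) (sph theta phi) = 1.
Proof.
rewrite dotE !mxE /= -(cos2Dsin2 theta) -[sin theta ^+ 2]mulr1 -(cos2Dsin2 phi).
by ring.
Qed.

Lemma dot_dsph (theta phi dtheta dphi : R) :
  dot (sph theta phi) (dsph theta phi dtheta dphi) = 0.
Proof.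
rewrite dotE !mxE /=.
transitivity (cos theta * sin theta * dtheta
  * (cos phi ^+ 2 + sin phi ^+ 2 - 1)); first by ring.
by rewrite cos2Dsin2 subrr mulr0.
Qed.

Lemma dot_dsph2 (theta phi a1 b1 a2 b2 : R) :
  dot (dsph theta phi a1 b1) (dsph theta phi a2 b2) =
  a1 * a2 + sin theta ^+ 2 * (b1 * b2).
Proof.
rewrite dotE !mxE /=.
transitivity (a1 * a2 * (cos theta ^+ 2 * (cos phi ^+ 2 + sin phi ^+ 2)
    + sin theta ^+ 2)
  + sin theta ^+ 2 * (cos phi ^+ 2 + sin phi ^+ 2) * (b1 * b2)); first by ring.
by rewrite cos2Dsin2 !mulr1 cos2Dsin2 mulr1.
Qed.

Lemma is_derive_chart (T : R -> R) dT (x v : 'rV[R]_4) :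
  is_derive (x 0 1) 1 T dT ->
  is_derive x v (chart T) (v 0 0 - dT * v 0 1, v 0 1,
                           dsph (x 0 2) (x 0 3) (v 0 2) (v 0 3)).
Proof.
move=> T'; have x' i := is_derive_mx_coord 0 i (is_derive_id x v).
apply: is_derive_pair; last exact: is_derive_sph.
apply: is_derive_pair => //; apply: is_deriveB => //.
exact: is_derive_comp.
Qed.

(** * The induced metric, in coordinates and on curves *)

Lemma induced_metric_y m L xi chi T dchi (x : 'rV[R]_4) :
  let r := x 0 1 in
  0 < r -> xi != 0 -> h m L r != 0 -> is_derive r 1 chi dchi ->
  is_derive r 1 T (dchi / h m L r) -> dchi ^+ 2 = Q m L xi r ->
  induced_metric (y m L xi chi \o chart T) x = SdS_metric m L x.
Proof.
move=> r r0 xi0 h0 chi' T' dchi2.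
apply/matrixP => mu nu; rewrite !mxE.
have D v : 'D_v (y m L xi chi \o chart T) x = dy m L xi dchi (chart T x)
    (v 0 0 - dchi / h m L r * v 0 1, v 0 1,
     dsph (x 0 2) (x 0 3) (v 0 2) (v 0 3)).
  by have [] := is_derive_y (c := chart T) m L xi r0 chi' (is_derive_chart v T').
(* Since du = dt - (chi'/h) dr in the chart, [subrK] turns du + (chi'/h) dr back into dt. *)
rewrite !D eta_dy //= ?dot_sph ?dot_dsph // dot_dsph2 !subrK -/r !mxE.
by case: mu => -[|[|[|[|//]]]] mu4; case: nu => -[|[|[|[|//]]]] nu4;
  rewrite /= ?eqxx ?mulr0 ?mulr1 ?mulr1n ?mulr0n; ring.
Qed.

(** Velocities of curves replace the coordinate vectors in [eta_dy]. The chain rule for t = u + T(r)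
    produces du + (chi'/h) dr. *)
Lemma SdS_form_y m L xi chi T dchi p (c1 c2 : R -> R * R * 'rV[R]_3) :
  let r := p.1.2 in
  spacetime p -> xi != 0 -> h m L r != 0 -> is_derive r 1 chi dchi ->
  is_derive r 1 T (dchi / h m L r) -> dchi ^+ 2 = Q m L xi r ->
  smooth_curve spacetime p c1 -> smooth_curve spacetime p c2 ->
  eta_form (derive1 (y m L xi chi \o c1) 0) (derive1 (y m L xi chi \o c2) 0)
  = SdS_form m L T c1 c2.
Proof.
move=> r [r0 ww] xi0 h0 chi' T' dchi2.
move=> /smooth_curve_is_derive[c10 c1' ww1] /smooth_curve_is_derive[c20 c2' ww2].
have dyE c : c 0 = p -> is_derive (0 : R) 1 c (derive1 c 0) ->
    derive1 (y m L xi chi \o c) 0 = dy m L xi dchi p (derive1 c 0).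
  by move=> c0 c'; rewrite -c0; apply: derive1_y => //; rewrite c0.
rewrite (dyE _ c10 c1') (dyE _ c20 c2') (eta_dy r0 xi0 h0 dchi2 ww ww1 ww2).
rewrite /SdS_form c10 -/r.
have t' c : c 0 = p -> is_derive (0 : R) 1 c (derive1 c 0) ->
  [/\ derive1 (fun s => (c s).1.1 + T (c s).1.2) 0
        = (derive1 c 0).1.1 + dchi / h m L r * (derive1 c 0).1.2,
      derive1 (fun s => (c s).1.2) 0 = (derive1 c 0).1.2
    & derive1 (fun s => (c s).2) 0 = (derive1 c 0).2].
  move=> c0 c'; rewrite !derive1E.
  have u' := is_derive_fst (is_derive_fst c').
  have r' := is_derive_snd (is_derive_fst c').
  have w' := is_derive_snd c'.
  have Tr' : is_derive (c 0).1.2 1 T (dchi / h m L r) by rewrite c0.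
  have t' := is_derive_add u' (is_derive_comp (f := fun s => (c s).1.2) Tr' r').
  by move: t' r' w'; rewrite derive1E => -[_ ->] [_ ->] [_ ->].
by have [-> -> ->] := t' _ c10 c1'; have [-> -> ->] := t' _ c20 c2'.
Qed.

End Embedding.

Theorem mainTheorem2 (R : realType) (m Lambda xi : R)
  (hm : 0 < m) (hLambda : 0 < Lambda)
  (hxi : Num.sqrt 27 / (64 * m) <= xi) :
  (forall r : R, 0 < r -> 0 <= Q m Lambda xi r) /\
  (exists sigma : R -> R,
     (forall r, 0 < r -> sigma r = 1 \/ sigma r = -1) /\
     smooth_on [set r : R | 0 < r]
       (fun r => sigma r * Num.sqrt (Q m Lambda xi r))) /\
  (forall sigma chi : R -> R,
     (forall r, 0 < r -> sigma r = 1 \/ sigma r = -1) ->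
     smooth_on [set r : R | 0 < r]
       (fun r => sigma r * Num.sqrt (Q m Lambda xi r)) ->
     (forall r : R, 0 < r ->
        is_derive r 1 chi (sigma r * Num.sqrt (Q m Lambda xi r))) ->
     smooth_embedding spacetime (y m Lambda xi chi) /\
     (forall r0 : R, 0 < r0 -> h m Lambda r0 != 0 ->
      let C := connected_component
                 [set r : R | 0 < r /\ h m Lambda r != 0] r0 in
      forall T : R -> R,
        (forall r : R, C r ->
           is_derive r 1 T (derive1 chi r / h m Lambda r)) ->
        (forall x : 'rV[R]_4, C (x 0 1) -> 0 < x 0 2 < pi ->
           induced_metric (y m Lambda xi chi \o chart T) x
           = SdS_metric m Lambda x) /\
        (forall p, spacetime p -> C p.1.2 ->
         forall c1 c2 : R -> R * R * 'rV[R]_3,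
           smooth_curve spacetime p c1 -> smooth_curve spacetime p c2 ->
           eta_form (derive1 (y m Lambda xi chi \o c1) 0)
                    (derive1 (y m Lambda xi chi \o c2) 0)
           = SdS_form m Lambda T c1 c2))).
Proof.
have op := @open_pos R.
have xi0 : xi != 0.
  by rewrite gt_eqF // (lt_le_trans _ hxi) // divr_gt0 ?sqrtr_gt0 ?mulr_gt0.
have Qpos r : 0 < r -> 0 < Q m Lambda xi r by exact: Q_gt0.
split; first by move=> r /Qpos/ltW.
split.
  exists (fun=> 1); split=> [r _|k]; first by left.
  apply: Ck_onM => //; first exact: Ck_on_cst.
  exact: Ck_on_comp op Qpos (Ck_on_sqrt k) (Ck_on_Q k m Lambda xi).
move=> sigma chi sigma1 smooth_dchi chi'.
(* An antiderivative of a C^k function is C^(k+1). *)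
have Cchi k : Ck_on k [set r : R | 0 < r] chi.
  exact/Ck_onW/(Ck_on_derive1 op chi')/smooth_dchi.
split.
  split; [exact: smooth_map_y | exact: immersion_y chi' |].
  exact: topological_embedding_y.
move=> r0 r0_gt0 hr0 C T T'.
have CP r : C r -> 0 < r /\ h m Lambda r != 0.
  by move=> /connected_component_sub.
(* The choice of sign disappears on squaring. *)
have dchi2 r : 0 < r ->
    (sigma r * Num.sqrt (Q m Lambda xi r)) ^+ 2 = Q m Lambda xi r.
  move=> r_gt0; rewrite exprMn sqr_sqrtr; last exact/ltW/Qpos.
  by case: (sigma1 r r_gt0) => ->; rewrite ?sqrrN expr1n mul1r.
(* The assumption on [T] is phrased with [derive1 chi], whose value is the prescribed derivative of
   [chi]. *)
have dT r : C r -> is_derive r 1 T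
    (sigma r * Num.sqrt (Q m Lambda xi r) / h m Lambda r).
  move=> Cr; have [r_gt0 _] := CP r Cr; have := T' r Cr.
  by rewrite derive1E; have [_ ->] := chi' r r_gt0.
split=> [x Cx _|p Mp Cp c1 c2].
  have [r_gt0 hr] := CP _ Cx.
  exact: induced_metric_y r_gt0 xi0 hr (chi' _ r_gt0) (dT _ Cx) (dchi2 _ r_gt0).
have [r_gt0 hr] := CP _ Cp.
exact: SdS_form_y Mp xi0 hr (chi' _ r_gt0) (dT _ Cp) (dchi2 _ r_gt0).
Qed.
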